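(* Let $x\in(0,\pi/2)$, $p\in\mathbb{R}$, and consider the double inequality \[ \frac{1-(\cos x)^{q_2}}{3q_2}<\frac{1-\left(\frac{\sin x}{x}\right)^{p}}{p}<\frac{1-(\cos x)^{q_1}}{3q_1}. \tag{$*$} \] (i) If $p\ge \frac{\pi^2}{4}-1$, then $( * )$ holds for $q_2\ge \frac p3+\frac8{15}$ and $q_1\le 1$. (ii) If $p\in[\frac75,\frac{\pi^2}{4}-1)$, then $( * )$ holds for $q_2\ge \frac p3+\frac8{15}$ and $q_1\le \frac{34}{35}$. (iii) If $p\in[\frac{46}{35},\frac75)$, then $( * )$ holds for $q_2\ge 1$ and $q_1\le\frac{34}{35}$. (iv) If $p<\frac{46}{35}$, then $( * )$ holds for $q_2\ge1$ and $q_1\le \frac p3+\frac8{15}$.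
   Context: When $p=0$, $\frac{1-(\sin x/x)^p}{p}$ means $-\ln\frac{\sin x}{x}$; when $q_i=0$, $\frac{1-(\cos x)^{q_i}}{3q_i}$ means $-\frac13\ln\cos x$ (the limits of these expressions). *)

(* Defs.v *)
From Stdlib Require Import Reals.
Open Scope R_scope.

Definition Fsin (p x : R) : R :=
  if Req_EM_T p 0 then - ln (sin x / x)
  else (1 - Rpower (sin x / x) p) / p.

Definition Gcos (q x : R) : R :=
  if Req_EM_T q 0 then - (1/3) * ln (cos x)
  else (1 - Rpower (cos x) q) / (3 * q).

Definition double_ineq (p q1 q2 x : R) : Prop :=
  Gcos q2 x < Fsin p x /\ Fsin p x < Gcos q1 x.

(* Main.v *)
Require Import Defs.
From Stdlib Require Import Reals Factorial Lra Lia.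
From Coquelicot Require Import Coquelicot.
Open Scope R_scope.

(** With [dpow p t] the integral of [u ^ (p - 1)] over [[t, 1]], the two sides are
    [Fsin p x = dpow p (sin x / x)] and [Gcos q x = dpow q (cos x) / 3], both antitone in their
    parameter. So only three families need proof: [Gcos (p/3 + 8/15) < Fsin p] for [p >= 7/5],
    [Fsin p < Gcos (p/3 + 8/15)] for [p <= 46/35], and [Fsin (PI^2/4 - 1) < Gcos 1].
    (The exponent [p/3 + 8/15] is the one for which the Taylor expansions agree up to [x^4].)

    All functions vanish at [0+], and the log of the quotient of the derivatives of [Fsin p] and
    [Gcos q] tends to [0] there, so the comparison follows from the sign of the derivative of
    that log. Clearing denominators, this is the sign of a trigonometric polynomial, affine in
    [p]. It is found by repeated differentiation, except for [p = 46/35], where the difference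
    starts only at [x^10] and Taylor polynomials are used. *)

(** * Signs from the mean value theorem *)

Lemma MVT_open (f df : R -> R) (a b : R) :
  a < b -> (forall y, a <= y <= b -> is_derive f y (df y)) ->
  exists c, a < c < b /\ f b - f a = df c * (b - a).
Proof.
  intros hab hf.
  assert (pr : forall c, a < c < b -> derivable_pt f c).
  { intros c hc. exists (df c). apply is_derive_Reals, hf. lra. }
  destruct (MVT_cor2 f df a b hab) as [c [hc1 hc2]].
  - intros c hc. apply is_derive_Reals, hf, hc.
  - exists c. tauto.
Qed.

Lemma lt_of_derive_pos (f df : R -> R) (a b : R) :
  a < b -> (forall y, a <= y <= b -> is_derive f y (df y)) ->
  (forall y, a < y < b -> 0 < df y) -> f a < f b.
Proof.
  intros hab hf hdf.
  destruct (MVT_open f df a b hab hf) as [c [hc e]].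
  specialize (hdf c hc). nra.
Qed.

Lemma le_of_derive_nonneg (f df : R -> R) (a b : R) :
  a <= b -> (forall y, a <= y <= b -> is_derive f y (df y)) ->
  (forall y, a < y < b -> 0 <= df y) -> f a <= f b.
Proof.
  intros [hab | <-] hf hdf; [|lra].
  destruct (MVT_open f df a b hab hf) as [c [hc e]].
  specialize (hdf c hc). nra.
Qed.

Lemma pos_of_derive_pos (f df : R -> R) (b : R) :
  f 0 = 0 -> (forall y, is_derive f y (df y)) ->
  (forall y, 0 < y < b -> 0 < df y) -> forall y, 0 < y < b -> 0 < f y.
Proof.
  intros h0 hf hdf y hy. rewrite <- h0.
  apply lt_of_derive_pos with df; [lra | auto |].
  intros z hz. apply hdf. lra.
Qed.

(** Serves functions such as [sin y / y], whose value at [0] is a convention and only whose limit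
    matters. By monotonicity a negative [f (y / 2)] would bound [f] away from [0] near [0+]; the
    half point then makes the inequality at [y] strict. *)
Lemma pos_of_derive_pos_lim (f df : R -> R) (b : R) :
  filterlim f (at_right 0) (locally 0) ->
  (forall y, 0 < y < b -> is_derive f y (df y)) ->
  (forall y, 0 < y < b -> 0 < df y) -> forall y, 0 < y < b -> 0 < f y.
Proof.
  intros hlim hf hdf y hy.
  assert (hmono : forall z w, 0 < z < w -> w < b -> f z < f w).
  { intros z w hz hw. apply lt_of_derive_pos with df; [lra | |];
      intros t ht; [apply hf | apply hdf]; lra. }
  apply Rle_lt_trans with (f (y / 2)); [|apply hmono; lra].
  apply Rnot_lt_le. intro hneg.
  assert (he : 0 < - f (y / 2)) by lra.
  destruct (proj1 (filterlim_locally f 0) hlim (mkposreal _ he)) as [d hd]; cbn in hd.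
  assert (hz : 0 < Rmin (d / 2) (y / 4) /\ Rmin (d / 2) (y / 4) <= y / 4
               /\ Rmin (d / 2) (y / 4) <= d / 2).
  { pose proof (cond_pos d).
    split; [apply Rmin_pos; lra | split; [apply Rmin_r | apply Rmin_l]]. }
  set (z := Rmin (d / 2) (y / 4)) in *.
  assert (hb : Rabs (z - 0) < d).
  { pose proof (cond_pos d). rewrite Rabs_pos_eq; lra. }
  specialize (hd z hb (proj1 hz)).
  unfold ball in hd; cbn in hd; unfold AbsRing_ball, abs, minus, plus, opp in hd; cbn in hd.
  apply Rabs_def2 in hd.
  assert (f z < f (y / 2)) by (apply hmono; lra). lra.
Qed.

(** * Trigonometric inequalities by repeated differentiation *)

Lemma sin_sub_mul_cos_pos (y : R) : 0 < y < PI -> 0 < sin y - y * cos y.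
Proof.
  intro hy.
  apply (pos_of_derive_pos (fun y => sin y - y * cos y) (fun y => y * sin y) PI);
    [rewrite sin_0; ring | | | exact hy].
  - intro z. auto_derive; [trivial | ring].
  - intros z hz. apply Rmult_lt_0_compat; [lra | apply sin_gt_0; lra].
Qed.

(** Two differentiations lead to [sin y - y * cos y]. At [y = 2 * x] the expression is a factor of
    the coefficient of [p] in [slope_num_balanced]. *)
Lemma cusa_huygens (y : R) : 0 < y < PI -> 0 < 2 * y + y * cos y - 3 * sin y.
Proof.
  apply (pos_of_derive_pos (fun y => 2 * y + y * cos y - 3 * sin y)
           (fun y => 2 - 2 * cos y - y * sin y)).
  { rewrite sin_0; ring. }
  { intro z. auto_derive; [trivial | ring]. }
  apply (pos_of_derive_pos _ (fun y => sin y - y * cos y)).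
  { rewrite cos_0; ring. }
  { intro z. auto_derive; [trivial | ring]. }
  apply sin_sub_mul_cos_pos.
Qed.

(** This comes from the case [p = 7 / 5], in the double angle [y = 2 * x]. The function and its
    first three derivatives vanish at [0], and the fourth is [y * (sin y - y * cos y)]. *)
Lemma lower_trig_poly_pos (y : R) : 0 < y < PI ->
  0 < 4 * y ^ 2 - 24 + 24 * cos y + 9 * y * sin y - y ^ 2 * cos y.
Proof.
  apply (pos_of_derive_pos
           (fun y => 4 * y ^ 2 - 24 + 24 * cos y + 9 * y * sin y - y ^ 2 * cos y)
           (fun y => 8 * y - 15 * sin y + 7 * y * cos y + y ^ 2 * sin y)).
  { rewrite sin_0, cos_0; ring. }
  { intro z. auto_derive; [trivial | ring]. }
  apply (pos_of_derive_pos _ (fun y => 8 - 8 * cos y - 5 * y * sin y + y ^ 2 * cos y)).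
  { rewrite sin_0; ring. }
  { intro z. auto_derive; [trivial | ring]. }
  apply (pos_of_derive_pos _ (fun y => 3 * sin y - 3 * y * cos y - y ^ 2 * sin y)).
  { rewrite cos_0; ring. }
  { intro z. auto_derive; [trivial | ring]. }
  apply (pos_of_derive_pos _ (fun y => y * (sin y - y * cos y))).
  { rewrite sin_0; ring. }
  { intro z. auto_derive; [trivial | ring]. }
  intros z hz. apply Rmult_lt_0_compat; [lra | now apply sin_sub_mul_cos_pos].
Qed.

(* The function, once nonpositive, is negative from then on: a form of "positive, then negative"
   that passes from [f'] to [f] without any sign information at the right end. *)
Definition downcrossing (b : R) (f : R -> R) : Prop :=
  forall y z, 0 < y < z -> z < b -> f y <= 0 -> f z < 0.

(** If [f y <= 0 = f 0], then [df] is nonpositive somewhere before [y], hence negative from [y] on,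
    so [f] decreases strictly there. *)
Lemma downcrossing_of_derive (b : R) (f df : R -> R) :
  f 0 = 0 -> (forall y, is_derive f y (df y)) ->
  downcrossing b df -> downcrossing b f.
Proof.
  intros h0 hf hdf y z hyz hz hy.
  destruct (MVT_open f df 0 y) as [c [hc e]]; [lra | auto |].
  assert (hdc : df c <= 0) by nra.
  destruct (MVT_open f df y z) as [d [hd e']]; [lra | auto |].
  assert (df d < 0) by (apply (hdf c d); lra). nra.
Qed.

Lemma mul_cot_decreasing (y z : R) :
  0 < y < z -> z < PI -> z * cos z / sin z < y * cos y / sin y.
Proof.
  intros hyz hz.
  enough (- (y * cos y / sin y) < - (z * cos z / sin z)) by lra.
  apply (lt_of_derive_pos (fun y => - (y * cos y / sin y))
           (fun y => (y - sin y * cos y) / sin y ^ 2)); [lra | |].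
  (* Writing [1] as [sin^2 + cos^2] lets [field] check the quotient rule with sine and cosine as
     independent atoms. *)
  - intros t ht. assert (0 < sin t) by (apply sin_gt_0; lra).
    replace (t - sin t * cos t) with (t * (Rsqr (sin t) + Rsqr (cos t)) - sin t * cos t)
      by (rewrite sin2_cos2; ring).
    unfold Rsqr. auto_derive; [lra | field; lra].
  - intros t ht. assert (0 < sin t) by (apply sin_gt_0; lra).
    apply Rdiv_lt_0_compat; [|nra].
    assert (sin t < t) by (apply sin_lt_x; lra).
    pose proof (COS_bound t). nra.
Qed.

(** The function vanishes at [0] and at [PI], and its derivative can only turn from positive to
    negative, so it is positive in between. That sign pattern passes up from the fourth derivative,
    [y * sin y * (4 * k - 2 + k * y * cot y)], where it holds because [y * cot y] decreases. *)
Lemma endpoint_trig_poly_pos (k y : R) : 0 < k -> k = PI ^ 2 / 4 - 2 -> 0 < y < PI ->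
  0 < k * (4 - 4 * cos y - 4 * y * sin y + y ^ 2 + y ^ 2 * cos y)
      - (2 * y ^ 2 - 8 + 8 * cos y + 2 * y * sin y).
Proof.
  intros hk hkpi hy.
  set (f := fun y => k * (4 - 4 * cos y - 4 * y * sin y + y ^ 2 + y ^ 2 * cos y)
      - (2 * y ^ 2 - 8 + 8 * cos y + 2 * y * sin y)).
  set (f1 := fun y => k * (2 * y - 2 * y * cos y - y ^ 2 * sin y)
      - (4 * y - 6 * sin y + 2 * y * cos y)).
  set (f2 := fun y => k * (2 - 2 * cos y - y ^ 2 * cos y)
      - (4 - 4 * cos y - 2 * y * sin y)).
  set (f3 := fun y => k * (2 * sin y - 2 * y * cos y + y ^ 2 * sin y)
      - (2 * sin y - 2 * y * cos y)).
  set (f4 := fun y => y * ((4 * k - 2) * sin y + k * y * cos y)).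
  assert (hf : forall y, is_derive f y (f1 y)).
  { intro z. unfold f, f1. auto_derive; [trivial | ring]. }
  assert (hf1 : forall y, is_derive f1 y (f2 y)).
  { intro z. unfold f1, f2. auto_derive; [trivial | ring]. }
  assert (hf2 : forall y, is_derive f2 y (f3 y)).
  { intro z. unfold f2, f3. auto_derive; [trivial | ring]. }
  assert (hf3 : forall y, is_derive f3 y (f4 y)).
  { intro z. unfold f3, f4. auto_derive; [trivial | ring]. }
  assert (d4 : downcrossing PI f4).
  { assert (e : forall y, 0 < y < PI ->
        f4 y = y * sin y * (4 * k - 2 + k * (y * cos y / sin y))).
    { intros z hz. assert (0 < sin z) by (apply sin_gt_0; lra).
      unfold f4. field. lra. }
    intros z w hzw hw. rewrite !e by lra. intro h.
    assert (0 < sin z) by (apply sin_gt_0; lra).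
    assert (0 < sin w) by (apply sin_gt_0; lra).
    pose proof (mul_cot_decreasing z w hzw hw).
    assert (0 < z * sin z) by nra. assert (0 < w * sin w) by nra.
    assert (4 * k - 2 + k * (z * cos z / sin z) <= 0) by nra.
    assert (4 * k - 2 + k * (w * cos w / sin w) < 0) by nra.
    nra. }
  assert (d1 : downcrossing PI f1).
  { apply downcrossing_of_derive with f2; [unfold f1; rewrite sin_0; ring | auto |].
    apply downcrossing_of_derive with f3; [unfold f2; rewrite cos_0; ring | auto |].
    apply downcrossing_of_derive with f4; [unfold f3; rewrite sin_0; ring | auto |].
    exact d4. }
  change (0 < f y). apply Rnot_le_lt. intro hneg.
  assert (f0 : f 0 = 0) by (unfold f; rewrite sin_0, cos_0; ring).
  (* This endpoint value is what singles out [k]. *)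
  assert (fpi : f PI = 0) by (unfold f; rewrite sin_PI, cos_PI, hkpi; field).
  destruct (MVT_open f f1 0 y) as [c [hc e]]; [lra | auto |].
  assert (hdc : f1 c <= 0) by nra.
  destruct (MVT_open f f1 y PI) as [d [hd e']]; [lra | auto |].
  assert (f1 d < 0) by (apply (d1 c d); lra). nra.
Qed.

(** * Taylor bounds for sine and cosine *)

Lemma INR_fact_S (n : nat) : INR (fact (S n)) = INR (S n) * INR (fact n).
Proof. rewrite fact_simpl. apply mult_INR. Qed.

Lemma is_derive_pow_div_fact (c : R) (m : nat) (x : R) :
  is_derive (fun y => c * (y ^ S m / INR (fact (S m)))) x (c * (x ^ m / INR (fact m))).
Proof.
  rewrite INR_fact_S.
  pose proof (INR_fact_neq_0 m). pose proof (not_0_INR (S m) ltac:(lia)).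
  auto_derive; [trivial |].
  (* [auto_derive] leaves the factor [INR (S m)] unfolded. *)
  change (match m with 0%nat => 1 | S _ => INR m + 1 end) with (INR (S m)).
  field. auto.
Qed.

Lemma is_derive_sin_approx (n : nat) (x : R) :
  is_derive (fun y => sin_approx y n) x (cos_approx x n).
Proof.
  assert (h : forall i, is_derive (fun y => sin_term y i) x (cos_term x i)).
  { intro i. unfold sin_term, cos_term. rewrite Nat.add_1_r.
    apply is_derive_pow_div_fact. }
  unfold sin_approx, cos_approx. induction n as [|n IH]; [apply h |].
  apply (is_derive_plus (fun y => sum_f_R0 (sin_term y) n) (fun y => sin_term y (S n)));
    [exact IH | apply h].
Qed.

Lemma is_derive_cos_approx (n : nat) (x : R) :
  is_derive (fun y => cos_approx y (S n)) x (- sin_approx x n).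
Proof.
  assert (h : forall i, is_derive (fun y => cos_term y (S i)) x (- sin_term x i)).
  { intro i. unfold sin_term, cos_term.
    replace (2 * S i)%nat with (S (2 * i + 1)) by lia.
    replace (- ((-1) ^ i * (x ^ (2 * i + 1) / INR (fact (2 * i + 1)))))
      with ((-1) ^ S i * (x ^ (2 * i + 1) / INR (fact (2 * i + 1)))) by (cbn; ring).
    apply is_derive_pow_div_fact. }
  unfold sin_approx, cos_approx. induction n as [|n IH].
  - replace (- sum_f_R0 (sin_term x) 0) with (plus 0 (- sin_term x 0))
      by (unfold plus; cbn; ring).
    apply (is_derive_plus (fun y => cos_term y 0) (fun y => cos_term y 1)); [|apply h].
    unfold cos_term. auto_derive; [trivial | cbn; ring].
  - replace (- sum_f_R0 (sin_term x) (S n))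
      with (plus (- sum_f_R0 (sin_term x) n) (- sin_term x (S n)))
      by (unfold plus; cbn; ring).
    apply (is_derive_plus (fun y => sum_f_R0 (cos_term y) (S n))
             (fun y => cos_term y (S (S n)))); [exact IH | apply h].
Qed.

Lemma sin_approx_0 (n : nat) : sin_approx 0 n = 0.
Proof.
  unfold sin_approx. induction n as [|n IH]; cbn [sum_f_R0]; [|rewrite IH];
    unfold sin_term; rewrite pow_i by lia; unfold Rdiv; ring.
Qed.

Lemma cos_approx_0 (n : nat) : cos_approx 0 n = 1.
Proof.
  unfold cos_approx. induction n as [|n IH]; cbn [sum_f_R0].
  - unfold cos_term. cbn. field.
  - rewrite IH. unfold cos_term. rewrite pow_i by lia. unfold Rdiv; ring.
Qed.

(** Starting from [cos x <= 1], integration from [0] turns the cosine bound of order [n] into the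
    sine bound of order [n], and that into the cosine bound of order [n + 1] with the opposite sign.
    All [x >= 0] are covered, as arguments [3 * x] up to [6] require. *)
Lemma sin_cos_approx (n : nat) (x : R) : 0 <= x ->
  0 <= (-1) ^ n * (cos_approx x n - cos x) /\
  0 <= (-1) ^ n * (sin_approx x n - sin x).
Proof.
  assert (hs : forall n,
    (forall x, 0 <= x -> 0 <= (-1) ^ n * (cos_approx x n - cos x)) ->
    forall x, 0 <= x -> 0 <= (-1) ^ n * (sin_approx x n - sin x)).
  { intros m hm y hy.
    apply Rle_trans with ((-1) ^ m * (sin_approx 0 m - sin 0));
      [rewrite sin_approx_0, sin_0; lra |].
    apply (le_of_derive_nonneg (fun y => (-1) ^ m * (sin_approx y m - sin y))
             (fun y => (-1) ^ m * (cos_approx y m - cos y)));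
      [exact hy | | intros z hz; apply hm; lra].
    intros z _. apply is_derive_scal.
    apply (is_derive_minus (fun y => sin_approx y m) sin);
      [apply is_derive_sin_approx | apply is_derive_sin]. }
  assert (hc : forall n x, 0 <= x -> 0 <= (-1) ^ n * (cos_approx x n - cos x)).
  { intro m. induction m as [|m IH]; intros y hy.
    - unfold cos_approx, cos_term. cbn. pose proof (COS_bound y). lra.
    - apply Rle_trans with ((-1) ^ S m * (cos_approx 0 (S m) - cos 0));
        [rewrite cos_approx_0, cos_0; lra |].
      apply (le_of_derive_nonneg (fun y => (-1) ^ S m * (cos_approx y (S m) - cos y))
               (fun y => (-1) ^ S m * (- sin_approx y m - - sin y)));
        [exact hy | |].
      + intros z _. apply is_derive_scal.
        apply (is_derive_minus (fun y => cos_approx y (S m)) cos);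
          [apply is_derive_cos_approx | apply is_derive_cos].
      + intros z hz. specialize (hs m IH z ltac:(lra)). cbn [pow]. lra. }
  intro hx. split; [now apply hc | apply hs; auto].
Qed.

Ltac expand_approx H :=
  unfold sin_approx, cos_approx, sin_term, cos_term in H;
  cbn [sum_f_R0 Nat.mul Nat.add] in H;
  rewrite ?INR_fact_S, ?INR_IZR_INZ in H; cbn in H.

(** This is [-140 * slope_num (46 / 35) (34 / 35) x], with products linearised into the angles [x]
    and [3 * x]. *)
Lemma upper_trig_poly_pos (x : R) : 0 < x <= 2 ->
  0 < 81 * cos x - 81 * cos (3 * x) - 54 * x * sin x - 58 * x * sin (3 * x)
      - 108 * x ^ 2 * cos x + 12 * x ^ 2 * cos (3 * x).
Proof.
  intro hx.
  (* Even orders bound from above the terms with a negative coefficient, odd orders bound from below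
     those with a positive one. *)
  destruct (sin_cos_approx 6 x) as [hc6 hs6]; [lra |].
  destruct (sin_cos_approx 7 x) as [hc7 _]; [lra |].
  destruct (sin_cos_approx 8 (3 * x)) as [hc8 hs8]; [lra |].
  destruct (sin_cos_approx 7 (3 * x)) as [hc7' _]; [lra |].
  assert (0 <= x ^ 2) by nra.
  apply (Rmult_le_compat_l (x ^ 2)) in hc6, hc7'; trivial.
  apply (Rmult_le_compat_l x) in hs6, hs8; try lra.
  rewrite Rmult_0_r in *.
  assert (ht : 0 < x ^ 2 <= 4) by nra.
  (* The combination of the Taylor bounds above has no term of degree below 10. *)
  assert (h : 0 < x ^ 10 * (64 / 525 - 32 / 1155 * x ^ 2 + (x ^ 2) ^ 2 *
    (1528 / 525525 - 19683 / 104366080 * x ^ 2 - 5137263 / 243955712000 * (x ^ 2) ^ 2))).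
  (* The linear part and the last bracket both decrease in [x ^ 2] and are still positive at
     [x ^ 2 = 4]. *)
  { apply Rmult_lt_0_compat; [apply pow_lt; lra |].
    apply Rplus_lt_le_0_compat; [lra |]. apply Rmult_le_pos; [apply pow2_ge_0 | nra]. }
  expand_approx hc6. expand_approx hs6. expand_approx hc7.
  expand_approx hs8. expand_approx hc8. expand_approx hc7'.
  cbn in h |- *. lra.
Qed.

(** * Both sides as one antitone family *)

(* [dpow p t] is the integral of [u ^ (p - 1)] over [[t, 1]], so that the two cases of its
   definition are one antitone function of [p]. *)
Definition dpow (p t : R) : R :=
  if Req_EM_T p 0 then - ln t else (1 - Rpower t p) / p.

Lemma Fsin_dpow (p x : R) : Fsin p x = dpow p (sin x / x).
Proof. reflexivity. Qed.

Lemma Gcos_dpow (q x : R) : Gcos q x = dpow q (cos x) / 3.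
Proof.
  unfold Gcos, dpow. destruct (Req_EM_T q 0) as [_ | hq]; field. exact hq.
Qed.

Lemma dpow_1 (p : R) : dpow p 1 = 0.
Proof.
  unfold dpow, Rpower. rewrite ln_1, Rmult_0_r, exp_0.
  destruct (Req_EM_T p 0); unfold Rdiv; ring.
Qed.

Lemma is_derive_dpow (p t : R) : 0 < t -> is_derive (dpow p) t (- Rpower t (p - 1)).
Proof.
  intro ht. unfold dpow. destruct (Req_EM_T p 0) as [-> | hp].
  - auto_derive; [exact ht |].
    replace (0 - 1) with (- (1)) by ring. rewrite Rpower_Ropp, Rpower_1 by exact ht. ring.
  - replace (p - 1) with (p + - (1)) by ring.
    rewrite Rpower_plus, Rpower_Ropp, Rpower_1 by exact ht.
    unfold Rpower. auto_derive; [auto | field; lra].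
Qed.

(** For [u <= 1] the integrand [u ^ (p - 1)] is antitone in [p]. *)
Lemma dpow_decr (p q t : R) : 0 < t <= 1 -> p <= q -> dpow q t <= dpow p t.
Proof.
  intros ht hpq.
  enough (dpow q t - dpow p t <= dpow q 1 - dpow p 1) by (rewrite !dpow_1 in *; lra).
  apply (le_of_derive_nonneg (fun t => dpow q t - dpow p t)
           (fun t => - Rpower t (q - 1) - - Rpower t (p - 1))); [lra | |].
  - intros u hu. apply (is_derive_minus (dpow q) (dpow p)); apply is_derive_dpow; lra.
  - intros u hu.
    enough (Rpower u (q - 1) <= Rpower u (p - 1)) by lra.
    assert (ln u < 0) by (rewrite <- ln_1; apply ln_increasing; lra).
    unfold Rpower. destruct (Req_dec ((q - 1) * ln u) ((p - 1) * ln u)) as [-> | hne]; [lra |].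
    left. apply exp_increasing. nra.
Qed.

Lemma sin_pos_half (x : R) : 0 < x < PI / 2 -> 0 < sin x.
Proof. intro hx. apply sin_gt_0; lra. Qed.

Lemma cos_pos_half (x : R) : 0 < x < PI / 2 -> 0 < cos x.
Proof. intro hx. apply cos_gt_0; lra. Qed.

Lemma sinc_bounds (x : R) : 0 < x < PI / 2 -> 0 < sin x / x < 1.
Proof.
  intro hx. pose proof (sin_pos_half x hx). split; [apply Rdiv_lt_0_compat; lra |].
  apply Rlt_div_l; [lra |]. rewrite Rmult_1_l. apply sin_lt_x; lra.
Qed.

Lemma Fsin_decr (p p' x : R) : 0 < x < PI / 2 -> p <= p' -> Fsin p' x <= Fsin p x.
Proof.
  intros hx hp. rewrite !Fsin_dpow. pose proof (sinc_bounds x hx).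
  apply dpow_decr; [lra | exact hp].
Qed.

Lemma Gcos_decr (q q' x : R) : 0 < x < PI / 2 -> q <= q' -> Gcos q' x <= Gcos q x.
Proof.
  intros hx hq. rewrite !Gcos_dpow. pose proof (cos_pos_half x hx).
  pose proof (COS_bound x).
  enough (dpow q' (cos x) <= dpow q (cos x)) by lra.
  apply dpow_decr; [lra | exact hq].
Qed.

(** * Limits at [0+] *)

Lemma filterlim_squeeze_1 (f : R -> R) :
  (forall y, 0 < y < 1 -> 1 - y ^ 2 <= f y <= 1) -> filterlim f (at_right 0) (locally 1).
Proof.
  intro hf. apply filterlim_locally. intro e.
  (* For [0 < y < Rmin e 1] one has [y ^ 2 < y < e]. *)
  assert (hd : 0 < Rmin e 1) by (apply Rmin_pos; [apply cond_pos | lra]).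
  exists (mkposreal _ hd). intros y hy h0.
  unfold ball in hy |- *; cbn in hy |- *.
  unfold AbsRing_ball, abs, minus, plus, opp in hy |- *; cbn in hy |- *.
  apply Rabs_def2 in hy.
  pose proof (Rmin_l e 1). pose proof (Rmin_r e 1).
  specialize (hf y ltac:(lra)).
  apply Rabs_def1; nra.
Qed.

Lemma filterlim_at_right_comp (f g : R -> R) (a b : R) :
  filterlim f (at_right 0) (locally a) -> ex_derive g a -> g a = b ->
  filterlim (fun y => g (f y)) (at_right 0) (locally b).
Proof.
  intros hf hg <-. apply filterlim_comp with (1 := hf).
  now apply (ex_derive_continuous g a).
Qed.

Lemma filterlim_at_right_scal (c : R) (f : R -> R) :
  filterlim f (at_right 0) (locally 0) ->
  filterlim (fun y => c * f y) (at_right 0) (locally 0).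
Proof.
  intro hf. apply (filterlim_at_right_comp f (Rmult c) 0 0 hf); [|ring].
  auto_derive; trivial.
Qed.

Lemma filterlim_at_right_minus (f g : R -> R) :
  filterlim f (at_right 0) (locally 0) -> filterlim g (at_right 0) (locally 0) ->
  filterlim (fun y => f y - g y) (at_right 0) (locally 0).
Proof.
  intros hf hg. apply (filterlim_at_right_scal (-1)) in hg.
  apply filterlim_ext with (fun y => plus (f y) (-1 * g y));
    [intro; unfold plus; cbn; ring |].
  replace (locally 0) with (locally (plus 0 0)) by (f_equal; unfold plus; cbn; ring).
  apply (filterlim_comp_2 _ _ _ hf hg), (filterlim_plus (0 : R) (0 : R)).
Qed.

Lemma filterlim_cos : filterlim cos (at_right 0) (locally 1).
Proof.
  eapply filterlim_filter_le_1; [apply filter_le_within |].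
  rewrite <- cos_0. apply (ex_derive_continuous cos 0). auto_derive; trivial.
Qed.

Lemma sin_ge_cubic (y : R) : 0 <= y -> y * (1 - y ^ 2) <= sin y.
Proof.
  intro hy. destruct (sin_cos_approx 1 y hy) as [_ h]. expand_approx h.
  pose proof (pow_le y 3 hy). nra.
Qed.

Lemma filterlim_sinc : filterlim (fun y => sin y / y) (at_right 0) (locally 1).
Proof.
  apply filterlim_squeeze_1. intros y hy.
  pose proof PI2_1. pose proof (sinc_bounds y ltac:(lra)).
  pose proof (sin_ge_cubic y ltac:(lra)).
  split; [apply Rle_div_r |]; lra.
Qed.

(** The reciprocal of this ratio is what [(Fsin p)' / (Gcos q)'] contains besides powers of
    [sin y / y] and [cos y]. The squeeze rests on [y ^ 2 * sin y <= 3 * (sin y - y * cos y) <= y ^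
    3]. *)
Lemma filterlim_slope_ratio :
  filterlim (fun y => y ^ 2 * sin y / (3 * (sin y - y * cos y))) (at_right 0) (locally 1).
Proof.
  apply filterlim_squeeze_1. intros y hy.
  pose proof PI2_1.
  pose proof (sin_sub_mul_cos_pos y ltac:(lra)) as h.
  split.
  - assert (hb : 3 * (sin y - y * cos y) <= y ^ 3).
    { enough (0 ^ 3 - 3 * (sin 0 - 0 * cos 0) <= y ^ 3 - 3 * (sin y - y * cos y))
        by (rewrite sin_0 in *; lra).
      apply (le_of_derive_nonneg (fun y => y ^ 3 - 3 * (sin y - y * cos y))
               (fun y => 3 * y * (y - sin y))); [lra | |].
      - intros z _. auto_derive; [trivial | ring].
      - intros z hz. assert (sin z < z) by (apply sin_lt_x; lra). nra. }
    apply Rle_div_r; [lra |].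
    apply Rle_trans with ((1 - y ^ 2) * y ^ 3); [apply Rmult_le_compat_l; [nra | exact hb] |].
    replace ((1 - y ^ 2) * y ^ 3) with (y ^ 2 * (y * (1 - y ^ 2))) by ring.
    apply Rmult_le_compat_l; [apply pow2_ge_0 | apply sin_ge_cubic; lra].
  - apply Rle_div_l; [lra |].
    enough (3 * (sin 0 - 0 * cos 0) - 0 ^ 2 * sin 0
              <= 3 * (sin y - y * cos y) - y ^ 2 * sin y) by (rewrite sin_0 in *; lra).
    apply (le_of_derive_nonneg (fun y => 3 * (sin y - y * cos y) - y ^ 2 * sin y)
             (fun y => y * (sin y - y * cos y))); [lra | |].
    + intros z _. auto_derive; [trivial | ring].
    + intros z hz. pose proof (sin_sub_mul_cos_pos z ltac:(lra)). nra.
Qed.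

(** * Comparison through the quotient of derivatives *)

(* The logarithm of [(Fsin p)' / (Gcos q)'] and its derivative. *)
Definition dlog_ratio (p q x : R) : R :=
  x * sin x / (sin x - x * cos x) - 2 / x - cos x / sin x
  + (p - 1) * (cos x / sin x - 1 / x) + (q - 1) * (sin x / cos x).

Definition log_ratio (p q x : R) : R :=
  - ln (x ^ 2 * sin x / (3 * (sin x - x * cos x)))
  + (p - 1) * ln (sin x / x) - (q - 1) * ln (cos x).

Lemma is_derive_log_ratio (p q x : R) : 0 < x < PI / 2 ->
  is_derive (log_ratio p q) x (dlog_ratio p q x).
Proof.
  intro hx. pose proof (sin_pos_half x hx). pose proof (cos_pos_half x hx).
  pose proof (sin_sub_mul_cos_pos x ltac:(lra)).
  unfold log_ratio, dlog_ratio. auto_derive.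
  - repeat split; try lra.
    + apply Rdiv_lt_0_compat; [|lra].
      apply (Rmult_lt_0_compat (x ^ 2)); [apply pow_lt |]; lra.
    + apply Rdiv_lt_0_compat; lra.
  - field. repeat split; lra.
Qed.

Lemma filterlim_log_ratio (p q : R) :
  filterlim (log_ratio p q) (at_right 0) (locally 0).
Proof.
  assert (hln : forall f, filterlim f (at_right 0) (locally 1) ->
    filterlim (fun y => ln (f y)) (at_right 0) (locally 0)).
  { intros f hf. apply (filterlim_at_right_comp f ln 1 0 hf); [|apply ln_1].
    auto_derive; lra. }
  apply filterlim_ext with (fun y =>
    (p - 1) * ln (sin y / y) - ln (y ^ 2 * sin y / (3 * (sin y - y * cos y)))
    - (q - 1) * ln (cos y)); [intro; unfold log_ratio; ring |].
  apply filterlim_at_right_minus; [apply filterlim_at_right_minus |].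
  - apply filterlim_at_right_scal, hln, filterlim_sinc.
  - apply hln, filterlim_slope_ratio.
  - apply filterlim_at_right_scal, hln, filterlim_cos.
Qed.

(** The factor in front is [(Gcos q)'], which is positive, and the exponential is the quotient of
    the derivatives; so the sign is that of [log_ratio]. *)
Lemma is_derive_Fsin_sub_Gcos (p q x : R) : 0 < x < PI / 2 ->
  is_derive (fun x => Fsin p x - Gcos q x) x
    (Rpower (cos x) (q - 1) * sin x / 3 * (exp (log_ratio p q x) - 1)).
Proof.
  intro hx. pose proof (sin_pos_half x hx) as hs. pose proof (cos_pos_half x hx) as hc.
  pose proof (sin_sub_mul_cos_pos x ltac:(lra)) as hd.
  pose proof (sinc_bounds x hx) as hS.
  apply is_derive_ext with (fun x => dpow p (sin x / x) - dpow q (cos x) / 3).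
  { intro t. now rewrite Gcos_dpow. }
  replace (Rpower (cos x) (q - 1) * sin x / 3 * (exp (log_ratio p q x) - 1))
    with ((x * cos x - sin x) / x ^ 2 * - Rpower (sin x / x) (p - 1)
          - / 3 * (- sin x * - Rpower (cos x) (q - 1))).
  - apply (is_derive_minus (fun x => dpow p (sin x / x)) (fun x => dpow q (cos x) / 3)).
    + apply (is_derive_comp (dpow p) (fun x => sin x / x)); [apply is_derive_dpow; lra |].
      auto_derive; [lra | field; lra].
    + apply is_derive_ext with (fun x => / 3 * dpow q (cos x)); [intro; apply Rmult_comm |].
      apply is_derive_scal. apply (is_derive_comp (dpow q) cos);
        [apply is_derive_dpow; lra | apply is_derive_cos].
  - replace (log_ratio p q x)
      with (- ln (x ^ 2 * sin x / (3 * (sin x - x * cos x)))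
            + ((p - 1) * ln (sin x / x) + - ((q - 1) * ln (cos x))))
      by (unfold log_ratio; ring).
    unfold Rpower. rewrite !exp_plus, !exp_Ropp, exp_ln.
    + field. split; [apply Rgt_not_eq, exp_pos | repeat split; lra].
    + apply Rdiv_lt_0_compat; [|lra].
      apply Rmult_lt_0_compat; [apply pow_lt |]; lra.
Qed.

Lemma filterlim_Fsin_sub_Gcos (p q : R) :
  filterlim (fun x => Fsin p x - Gcos q x) (at_right 0) (locally 0).
Proof.
  assert (hdp : forall r f, filterlim f (at_right 0) (locally 1) ->
    filterlim (fun y => dpow r (f y)) (at_right 0) (locally 0)).
  { intros r f hf. apply (filterlim_at_right_comp f (dpow r) 1 0 hf); [|apply dpow_1].
    eexists. apply is_derive_dpow; lra. }
  apply filterlim_ext with (fun x => dpow p (sin x / x) - / 3 * dpow q (cos x)).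
  { intro t. rewrite Gcos_dpow, Fsin_dpow. unfold Rdiv. ring. }
  apply filterlim_at_right_minus; [apply hdp, filterlim_sinc |].
  apply filterlim_at_right_scal, hdp, filterlim_cos.
Qed.

(* The factor [e] treats both directions at once; it is used with [1] and [-1]. *)
Lemma Fsin_sub_Gcos_sign (e p q : R) :
  (forall x, 0 < x < PI / 2 -> 0 < e * dlog_ratio p q x) ->
  forall x, 0 < x < PI / 2 -> 0 < e * (Fsin p x - Gcos q x).
Proof.
  intro h.
  apply (pos_of_derive_pos_lim (fun x => e * (Fsin p x - Gcos q x))
    (fun x => e * (Rpower (cos x) (q - 1) * sin x / 3 * (exp (log_ratio p q x) - 1)))).
  - apply filterlim_at_right_scal, filterlim_Fsin_sub_Gcos.
  - intros x hx. apply is_derive_scal, is_derive_Fsin_sub_Gcos, hx.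
  - intros x hx.
    assert (hL : 0 < e * log_ratio p q x).
    { apply (pos_of_derive_pos_lim (fun x => e * log_ratio p q x)
               (fun x => e * dlog_ratio p q x) (PI / 2)); try assumption.
      - apply filterlim_at_right_scal, filterlim_log_ratio.
      - intros y hy. apply is_derive_scal, is_derive_log_ratio, hy. }
    pose proof (sin_pos_half x hx).
    assert (0 < Rpower (cos x) (q - 1)) by apply exp_pos.
    assert (0 < e * (exp (log_ratio p q x) - 1)).
    { rewrite <- exp_0. set (u := log_ratio p q x) in *.
      destruct (Rlt_or_le 0 u).
      - assert (exp 0 < exp u) by (apply exp_increasing; lra). nra.
      - assert (u < 0) by (destruct (Req_dec u 0) as [-> | ]; lra).
        assert (exp u < exp 0) by (apply exp_increasing; lra). nra. }
    replace (e * (Rpower (cos x) (q - 1) * sin x / 3 * (exp (log_ratio p q x) - 1)))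
      with (Rpower (cos x) (q - 1) * sin x / 3 * (e * (exp (log_ratio p q x) - 1))) by ring.
    apply Rmult_lt_0_compat; [|assumption].
    apply Rdiv_lt_0_compat; [now apply Rmult_lt_0_compat | lra].
Qed.

(** * The numerator and its sign *)

(* [dlog_ratio p q x] with its positive denominators cleared. *)
Definition slope_num (p q x : R) : R :=
  cos x * (x ^ 2 - 2 * sin x ^ 2 + x * sin x * cos x
           - (p - 1) * (sin x - x * cos x) ^ 2)
  + (q - 1) * (sin x - x * cos x) * x * sin x ^ 2.

(** In this form [ring] can use the Pythagorean identity to eliminate squares of the sine. *)
Lemma sin_mul_sin (x : R) : sin x * sin x = 1 - cos x * cos x.
Proof. apply sin2. Qed.

Lemma dlog_ratio_eq (p q x : R) : 0 < x < PI / 2 ->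
  dlog_ratio p q x = slope_num p q x / (x * sin x * cos x * (sin x - x * cos x)).
Proof.
  intro hx. pose proof (sin_pos_half x hx). pose proof (cos_pos_half x hx).
  pose proof (sin_sub_mul_cos_pos x ltac:(lra)).
  pose proof (sin_mul_sin x) as e.
  unfold dlog_ratio, slope_num. field_simplify_eq; [ring [e] | repeat split; lra].
Qed.

Lemma Fsin_sub_Gcos_sign_num (e p q : R) :
  (forall x, 0 < x < PI / 2 -> 0 < e * slope_num p q x) ->
  forall x, 0 < x < PI / 2 -> 0 < e * (Fsin p x - Gcos q x).
Proof.
  intro h. apply Fsin_sub_Gcos_sign. intros x hx.
  pose proof (sin_pos_half x hx). pose proof (cos_pos_half x hx).
  pose proof (sin_sub_mul_cos_pos x ltac:(lra)).
  rewrite dlog_ratio_eq by exact hx. unfold Rdiv. rewrite <- Rmult_assoc.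
  apply Rdiv_lt_0_compat; [now apply h |].
  repeat apply Rmult_lt_0_compat; lra.
Qed.

(** With the balanced exponent the numerator is affine in [p]; it is expanded at [p = 7 / 5], where
    [q = 1]. The coefficient of [p] is a product of two positive factors, so the numerator increases
    with [p] and only the extreme values [7 / 5] and [46 / 35] need their own inequality. *)
Lemma slope_num_balanced (p x : R) :
  slope_num p (p / 3 + 8 / 15) x =
  cos x * (4 * (2 * x) ^ 2 - 24 + 24 * cos (2 * x) + 9 * (2 * x) * sin (2 * x)
           - (2 * x) ^ 2 * cos (2 * x)) / 20
  + (p - 7 / 5) / 6 * (sin x - x * cos x)
    * (2 * (2 * x) + 2 * x * cos (2 * x) - 3 * sin (2 * x)).
Proof.
  unfold slope_num. rewrite sin_2a, cos_2a. pose proof (sin_mul_sin x) as e.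
  field_simplify_eq. ring [e].
Qed.

Lemma Gcos_lt_Fsin (p x : R) : 7 / 5 <= p -> 0 < x < PI / 2 ->
  Gcos (p / 3 + 8 / 15) x < Fsin p x.
Proof.
  intros hp hx.
  enough (0 < 1 * (Fsin p x - Gcos (p / 3 + 8 / 15) x)) by lra.
  revert x hx. apply Fsin_sub_Gcos_sign_num. intros x hx.
  rewrite slope_num_balanced, Rmult_1_l.
  pose proof (cos_pos_half x hx).
  pose proof (sin_sub_mul_cos_pos x ltac:(lra)).
  pose proof (lower_trig_poly_pos (2 * x) ltac:(lra)). pose proof (cusa_huygens (2 * x) ltac:(lra)).
  apply Rplus_lt_le_0_compat.
  - apply Rdiv_lt_0_compat; [now apply Rmult_lt_0_compat | lra].
  - repeat apply Rmult_le_pos; lra.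
Qed.

Lemma Fsin_lt_Gcos (p x : R) : p <= 46 / 35 -> 0 < x < PI / 2 ->
  Fsin p x < Gcos (p / 3 + 8 / 15) x.
Proof.
  intros hp hx.
  enough (0 < -1 * (Fsin p x - Gcos (p / 3 + 8 / 15) x)) by lra.
  revert x hx. apply Fsin_sub_Gcos_sign_num. intros x hx.
  pose proof (sin_sub_mul_cos_pos x ltac:(lra)).
  pose proof (cusa_huygens (2 * x) ltac:(lra)).
  (* [PI <= 4] places [x] below [2], the range of the Taylor estimate. *)
  pose proof PI_4.
  pose proof (upper_trig_poly_pos x ltac:(lra)) as hE.
  apply Rlt_le_trans with (-1 * slope_num (46 / 35) (46 / 35 / 3 + 8 / 15) x).
  - replace (-1 * slope_num (46 / 35) (46 / 35 / 3 + 8 / 15) x)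
      with ((81 * cos x - 81 * cos (3 * x) - 54 * x * sin x - 58 * x * sin (3 * x)
      - 108 * x ^ 2 * cos x + 12 * x ^ 2 * cos (3 * x)) / 140); [lra |].
    rewrite slope_num_balanced. replace (3 * x) with (2 * x + x) by ring.
    rewrite sin_plus, cos_plus, sin_2a, cos_2a. pose proof (sin_mul_sin x) as e.
    field_simplify_eq. ring [e].
  - rewrite !slope_num_balanced.
    assert (0 < (sin x - x * cos x)
      * (2 * (2 * x) + 2 * x * cos (2 * x) - 3 * sin (2 * x))) by now apply Rmult_lt_0_compat.
    nra.
Qed.

(** At [q = 1] the last summand of [slope_num] drops out, and the rest is [- cos x / 8] times the
    function of [endpoint_trig_poly_pos] at [2 * x]. *)
Lemma Fsin_lt_Gcos_1 (x : R) : 0 < x < PI / 2 -> Fsin (PI ^ 2 / 4 - 1) x < Gcos 1 x.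
Proof.
  intro hx.
  enough (0 < -1 * (Fsin (PI ^ 2 / 4 - 1) x - Gcos 1 x)) by lra.
  revert x hx. apply Fsin_sub_Gcos_sign_num. intros x hx.
  pose proof (cos_pos_half x hx).
  assert (hk : 0 < PI ^ 2 / 4 - 2) by (pose proof PI2_3_2; unfold PI2 in *; nra).
  pose proof (endpoint_trig_poly_pos _ (2 * x) hk eq_refl ltac:(lra)) as h.
  set (k := PI ^ 2 / 4 - 2) in *.
  replace (PI ^ 2 / 4 - 1) with (k + 1) by (unfold k; ring).
  replace (-1 * slope_num (k + 1) 1 x) with (cos x * (
    (k * (4 - 4 * cos (2 * x) - 4 * (2 * x) * sin (2 * x) + (2 * x) ^ 2 + (2 * x) ^ 2 * cos (2 * x))
      - (2 * (2 * x) ^ 2 - 8 + 8 * cos (2 * x) + 2 * (2 * x) * sin (2 * x))) / 8)).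
  - apply Rmult_lt_0_compat; lra.
  - unfold slope_num. rewrite sin_2a, cos_2a. pose proof (sin_mul_sin x) as e.
    field_simplify_eq. ring [e].
Qed.

(** * Assembling the four ranges of [p] *)

Theorem theorem2 (x p q1 q2 : R) (hx : 0 < x < PI / 2) :
  (PI ^ 2 / 4 - 1 <= p ->
     q2 >= p / 3 + 8 / 15 -> q1 <= 1 -> double_ineq p q1 q2 x) /\
  (7 / 5 <= p < PI ^ 2 / 4 - 1 ->
     q2 >= p / 3 + 8 / 15 -> q1 <= 34 / 35 -> double_ineq p q1 q2 x) /\
  (46 / 35 <= p < 7 / 5 ->
     q2 >= 1 -> q1 <= 34 / 35 -> double_ineq p q1 q2 x) /\
  (p < 46 / 35 ->
     q2 >= 1 -> q1 <= p / 3 + 8 / 15 -> double_ineq p q1 q2 x).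
Proof.
  assert (lower : 7 / 5 <= p -> q2 >= p / 3 + 8 / 15 -> Gcos q2 x < Fsin p x).
  { intros hp hq. apply Rle_lt_trans with (Gcos (p / 3 + 8 / 15) x).
    - apply Gcos_decr; lra.
    - now apply Gcos_lt_Fsin. }
  (* The balanced exponent of [p = 7 / 5] is [1]. *)
  assert (lower' : p <= 7 / 5 -> q2 >= 1 -> Gcos q2 x < Fsin p x).
  { intros hp hq. apply Rlt_le_trans with (Fsin (7 / 5) x); [|now apply Fsin_decr].
    apply Rle_lt_trans with (Gcos (7 / 5 / 3 + 8 / 15) x).
    - apply Gcos_decr; lra.
    - apply Gcos_lt_Fsin; lra. }
  (* The balanced exponent of [p = 46 / 35] is [34 / 35]. *)
  assert (upper : 46 / 35 <= p -> q1 <= 34 / 35 -> Fsin p x < Gcos q1 x).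
  { intros hp hq. apply Rle_lt_trans with (Fsin (46 / 35) x); [now apply Fsin_decr |].
    apply Rlt_le_trans with (Gcos (46 / 35 / 3 + 8 / 15) x).
    - apply Fsin_lt_Gcos; lra.
    - apply Gcos_decr; lra. }
  (* This puts case (i) in the range of [lower]. Since [(31 / 20) ^ 2 > 12 / 5], it suffices that
     [cos (31 / 20) > 0], which the Taylor polynomial of degree 6 shows. *)
  assert (hpi : 7 / 5 <= PI ^ 2 / 4 - 1).
  { enough (31 / 20 < PI / 2) by nra.
    apply Rnot_le_lt. intro h.
    destruct (sin_cos_approx 3 (31 / 20)) as [h' _]; [lra |].
    expand_approx h'.
    assert (cos (31 / 20) <= 0) by (pose proof PI2_1; apply cos_le_0; lra). lra. }
  repeat split; try (apply lower; lra); try (apply lower'; lra); try (apply upper; lra).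
  (* The upper bounds of (i) and (iv) remain. *)
  - apply Rle_lt_trans with (Fsin (PI ^ 2 / 4 - 1) x); [now apply Fsin_decr |].
    apply Rlt_le_trans with (Gcos 1 x); [now apply Fsin_lt_Gcos_1 | now apply Gcos_decr].
  - apply Rlt_le_trans with (Gcos (p / 3 + 8 / 15) x);
      [apply Fsin_lt_Gcos; lra | now apply Gcos_decr].
Qed.
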